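(* Let $n\ge 2$, let $\Omega\subset\mathbb{R}^n$ be open and bounded, let $d={\rm diam}(\Omega)$, let $f\in\mathcal{C}(\Omega)$ and $u\in\mathcal{C}(\overline\Omega)$. (i) If $-\Delta_\infty^N u\le f(x)$ in $\Omega$ in the viscosity sense, then $$\big(\sup_{\Omega}u^{+}-\sup_{\partial\Omega}u^{+}\big)^2\le 2\,d^2\int_{\sup_{\partial\Omega}u^{+}}^{\sup_{\Omega}u^{+}}\big\|f^{+}\cdot 1_{C^{+}(u)}\big\|_{L^\infty(\{u^{+}=r\})}\,dr .$$ (ii) If $-\Delta_\infty^N u\ge f(x)$ in $\Omega$ in the viscosity sense, then $$\big(\sup_{\Omega}u^{-}-\sup_{\partial\Omega}u^{-}\big)^2\le 2\,d^2\int_{\sup_{\partial\Omega}u^{-}}^{\sup_{\Omega}u^{-}}\big\|f^{-}\cdot 1_{C^{+}(-u)}\big\|_{L^\infty(\{u^{-}=r\})}\,dr .$$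
   Context: Notation: $a^+=\max\{0,a\}$, $a^-=\max\{0,-a\}$; $1_A$ is the indicator function of $A$; for a symmetric matrix $X$, $M(X)$ and $m(X)$ are its greatest and smallest eigenvalues. The normalized infinity Laplacian is $\Delta_\infty^N\varphi=\big\langle D^2\varphi\,\frac{\nabla\varphi}{|\nabla\varphi|},\frac{\nabla\varphi}{|\nabla\varphi|}\big\rangle$ where $\nabla\varphi\ne0$. Viscosity sense: an upper semicontinuous $u:\Omega\to\mathbb{R}$ satisfies $-\Delta_\infty^N u\le f$ in $\Omega$ (subsolution) if for all $x_0\in\Omega$ and $\varphi\in\mathcal{C}^2(\Omega)$ such that $u-\varphi$ has a local maximum at $x_0$: $-\Delta_\infty^N\varphi(x_0)\le f(x_0)$ if $\nabla\varphi(x_0)\neq0$, and $-M(D^2\varphi(x_0))\le f(x_0)$ if $\nabla\varphi(x_0)=0$. A lower semicontinuous $u$ satisfies $-\Delta_\infty^N u\ge f$ in $\Omega$ (supersolution) if for all $x_0\in\Omega$ and $\varphi\in\mathcal{C}^2(\Omega)$ such that $u-\varphi$ has a local minimum at $x_0$: $-\Delta_\infty^N\varphi(x_0)\ge f(x_0)$ if $\nabla\varphi(x_0)\ne0$, and $-m(D^2\varphi(x_0))\ge f(x_0)$ if $\nabla\varphi(x_0)=0$. Concave envelope and upper contact set: for $w\in\mathcal{C}(\overline\Omega)$ and $x\in\Omega$, $\Gamma(w)(x)=\inf\{L(x): L \text{ affine},\ L\ge w \text{ in }\Omega\}$ and $C^+(w)=\{x\in\Omega: w(x)=\Gamma(w)(x)\}$.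 $\|g\|_{L^\infty(\{u^\pm=r\})}$ denotes the (pointwise) supremum of $|g|$ over the level set $\{x\in\Omega:u^\pm(x)=r\}$. The right-hand sides may be $+\infty$. *)

(* Defs.v *)
From HB Require Import structures.
From mathcomp Require Import all_boot all_order all_algebra.
From mathcomp Require Import all_classical all_reals all_analysis.

Set Implicit Arguments.
Unset Strict Implicit.
Unset Printing Implicit Defensive.

Import Order.TTheory GRing.Theory Num.Theory.
Import numFieldNormedType.Exports.

Local Open Scope classical_set_scope.
Local Open Scope ring_scope.

Section Euclidean.
Context {R : realType} {n : nat}.
Implicit Types (x y : 'rV[R]_n) (A : set 'rV[R]_n).

Definition dot x y : R := \sum_i x 0 i * y 0 i.

(* The library norm on 'rV[R]_n is the max norm. It induces the same topology
   and the same bounded sets, but lengths and diameters need the Euclidean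
   one. *)
Definition enorm x : R := Num.sqrt (dot x x).

Definition diam A : R := sup [set enorm (p.1 - p.2) | p in A `*` A].

Definition boundary A : set 'rV[R]_n := closure A `\` interior A.

End Euclidean.

Section Calculus.
Context {R : realType} {n : nat}.
Implicit Types (Omega : set 'rV[R]_n) (phi : 'rV[R]_n -> R).

Definition partial (i : 'I_n) phi : 'rV[R]_n -> R :=
  fun x => 'D_(delta_mx 0 i : 'rV[R]_n) phi x.

Definition C1_on Omega phi : Prop :=
  {within Omega, continuous phi} /\
  forall i : 'I_n,
    (forall x, Omega x -> derivable phi x (delta_mx 0 i : 'rV[R]_n)) /\
    {within Omega, continuous (partial i phi)}.

Definition C2_on Omega phi : Prop :=
  C1_on Omega phi /\ forall i : 'I_n, C1_on Omega (partial i phi).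

Definition grad phi (x : 'rV[R]_n) : 'rV[R]_n := \row_i partial i phi x.

Definition hessian phi (x : 'rV[R]_n) : 'M[R]_n :=
  \matrix_(i, j) partial i (partial j phi) x.

(* A symmetric real matrix of positive size has a finite nonempty set of
   eigenvalues, so that this sup and this inf are attained. *)
Definition max_eigenvalue (X : 'M[R]_n) : R := sup [set a | eigenvalue X a].
Definition min_eigenvalue (X : 'M[R]_n) : R := inf [set a | eigenvalue X a].

Definition ninf_laplacian phi (x : 'rV[R]_n) : R :=
  let e := (enorm (grad phi x))^-1 *: grad phi x in
  dot (e *m hessian phi x) e.

End Calculus.

Section Viscosity.
Context {R : realType} {n : nat}.
Implicit Types (Omega : set 'rV[R]_n) (u f : 'rV[R]_n -> R).

(* The library notion of lower semicontinuity concerns functions on the whole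
   space; here functions matter only on Omega. *)
Definition usc_on Omega u : Prop :=
  forall x, Omega x -> forall a, u x < a ->
    \forall y \near within Omega (nbhs x), u y < a.

Definition lsc_on Omega u : Prop :=
  forall x, Omega x -> forall a, a < u x ->
    \forall y \near within Omega (nbhs x), a < u y.

Definition local_max_on Omega (g : 'rV[R]_n -> R) (x0 : 'rV[R]_n) : Prop :=
  \forall y \near within Omega (nbhs x0), g y <= g x0.

Definition local_min_on Omega (g : 'rV[R]_n -> R) (x0 : 'rV[R]_n) : Prop :=
  \forall y \near within Omega (nbhs x0), g x0 <= g y.

Definition viscosity_subsolution Omega f u : Prop :=
  usc_on Omega u /\
  forall (x0 : 'rV[R]_n) (phi : 'rV[R]_n -> R),
    Omega x0 -> C2_on Omega phi -> local_max_on Omega (u \- phi) x0 ->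
    (grad phi x0 != 0 -> - ninf_laplacian phi x0 <= f x0) /\
    (grad phi x0 = 0 -> - max_eigenvalue (hessian phi x0) <= f x0).

Definition viscosity_supersolution Omega f u : Prop :=
  lsc_on Omega u /\
  forall (x0 : 'rV[R]_n) (phi : 'rV[R]_n -> R),
    Omega x0 -> C2_on Omega phi -> local_min_on Omega (u \- phi) x0 ->
    (grad phi x0 != 0 -> f x0 <= - ninf_laplacian phi x0) /\
    (grad phi x0 = 0 -> f x0 <= - min_eigenvalue (hessian phi x0)).

End Viscosity.

Section ContactSet.
Context {R : realType} {n : nat}.
Implicit Types (Omega : set 'rV[R]_n) (w : 'rV[R]_n -> R).

Definition affine_fun (L : 'rV[R]_n -> R) : Prop :=
  exists (p : 'rV[R]_n) (c : R), forall x, L x = dot p x + c.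

Definition concave_envelope Omega w (x : 'rV[R]_n) : R :=
  inf [set L x | L in [set L | affine_fun L /\
                               forall y, Omega y -> w y <= L y]].

Definition upper_contact_set Omega w : set 'rV[R]_n :=
  [set x | Omega x /\ w x = concave_envelope Omega w x].

End ContactSet.

(* Pointwise, not essential, supremum of |g| over A, taken in [0, +oo]: it is 0
   when A is empty, where ereal_sup alone would give -oo. *)
Definition sup_norm_on {T : Type} {R : realType} (A : set T) (g : T -> R)
    : \bar R :=
  maxe 0%E (ereal_sup [set (`|g x|)%:E | x in A]).

(* Main.v *)
Require Import Defs.
From HB Require Import structures.
From mathcomp Require Import all_boot all_order all_algebra.
From mathcomp Require Import all_classical all_reals all_analysis.
From mathcomp Require Import measurable_realfun ring lra.

Import Order.TTheory GRing.Theory Num.Theory.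
Import numFieldNormedType.Exports.

Set Implicit Arguments.
Unset Strict Implicit.
Unset Printing Implicit Defensive.

Local Open Scope classical_set_scope.
Local Open Scope ring_scope.

(** Testing with functions of one coordinate [t x = x 0 i] only, the normalized
    infinity Laplacian becomes a second derivative wherever the slope is not 0,
    and the estimate becomes one-dimensional.  Suppose that a continuous
    [G > 0] dominates [f^+] at the contact points, level by level, and that
    [2 * int_a^b G < ((b - a) / d)^2], with [b = max u] and [a > max u^+] on the
    boundary.  The increasing concave solution [phi] of [phi'' = - G(phi)], whose
    slope decreases from less than [(b - a) / d] at height [a] to a positive
    value at height [b], is slid until [phi (t x - c)] touches [u] from above.
    As [phi] needs a width larger than [d] to climb from [a] to [b], it touches
    at a height [r > a], hence inside [Omega]; as [phi] is concave, its tangent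
    lies above [u], so the point is a contact point.  There the viscosity
    inequality gives [G r <= f], a contradiction.  The theorem follows by letting
    [G] decrease to the supremum of [f^+] over level sets and then [a] decrease
    to the maximum over the boundary. *)

(** * Antiderivatives and the mean value theorem on open intervals *)

Lemma ex_antiderivative (R : realType) (h : R -> R) (lo hi : R) :
  (forall x, x \in `[lo, hi] -> {for x, continuous h}) ->
  exists H : R -> R, forall x, x \in `]lo, hi[ -> is_derive x 1 H (h x).
Proof.
move=> hc; pose H x := \int[lebesgue_measure]_(t in `[lo, x]) h t.
exists H => x xI; have /andP[lox xhi] : lo < x < hi by move: xI; rewrite in_itv.
have ih : (@lebesgue_measure R).-integrable `[lo, hi] (EFin \o h).
  apply: continuous_compact_integrable; first exact: segment_compact.
  apply: continuous_in_subspaceT => y /set_mem/= yI; exact: hc.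
have [dH <-] := @continuous_FTC1_closed _ h lo x hi xhi ih lox
  (hc _ (subset_itv_oo_cc xI)).
by rewrite derive1E; apply: DeriveDef.
Qed.

Lemma is_derive_segment_MVT (R : realType) (f df : R -> R) (lo hi a b : R) :
  (forall x, x \in `]lo, hi[ -> is_derive x 1 f (df x)) ->
  lo < a -> a <= b -> b < hi ->
  exists2 c, a <= c <= b & f b - f a = df c * (b - a).
Proof.
move=> fd loa ab bhi.
have sub x : x \in `[a, b] -> x \in `]lo, hi[.
  by rewrite !in_itv/= => /andP[ax xb]; rewrite (lt_le_trans loa)// (le_lt_trans xb).
have fd' x : x \in `]a, b[ -> is_derive x 1 f (df x).
  by move=> xab; apply: fd; apply: sub; apply: (@subset_itv_oo_cc _ _ a b).
have fc : {within `[a, b], continuous f}.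
  apply: derivable_within_continuous => x /sub/fd fx.
  exact: (@ex_derive _ _ _ _ _ _ _ fx).
have [c cab fE] := MVT_segment ab fd' fc.
by exists c => //; move: cab; rewrite in_itv.
Qed.

Lemma is_derive1_continuous (R : realType) (f : R -> R) (x df : R) :
  is_derive x 1 f df -> {for x, continuous f}.
Proof.
move=> fx; apply: differentiable_continuous; apply/derivable1_diffP.
exact: ex_derive.
Qed.

(** * The one-dimensional concave profile, obtained by conservation of energy *)

Section energy_profile.
Context {R : realType}.
Variables (G : R -> R) (a b E : R).
Hypotheses (Gc : continuous G) (G0 : forall r : R, 0 < G r) (ab : a < b).

(** [V] is the potential of the motion [phi'' = - G(phi)], along which the squared slope plus
    [2 * V] is conserved. The margin 2 around [[a, b]] leaves room to differentiate at [a] and [b]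
    and, in the profile, on a closed margin of width 1. *)
Lemma ex_energy : (2%:E * \int[lebesgue_measure]_(r in `[a, b]) (G r)%:E < E%:E)%E ->
  exists V : R -> R, (forall r : R, r \in `](a - 2), (b + 2)[ -> is_derive r 1 V (G r)) /\
    2 * (V b - V a) < E.
Proof.
move=> GE; have [|V VG] := @ex_antiderivative R G (a - 2) (b + 2).
  by move=> x _; exact: Gc.
exists V; split => //; rewrite -lte_fin; apply: le_lt_trans GE.
have sub x : x \in `[a, b] -> x \in `](a - 2), (b + 2)[.
  by rewrite !in_itv/= => /andP[ax xb]; apply/andP; split; lra.
have Vc x : x \in `[a, b] -> {for x, continuous V}.
  by move=> /sub/VG; exact: is_derive1_continuous.
rewrite (@continuous_FTC2 _ G V) //.
- exact: continuous_subspaceT.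
- split.
  + move=> x xab; have Vx := VG x (sub _ (subset_itv_oo_cc xab)).
    exact: (@ex_derive _ _ _ _ _ _ _ Vx).
  + by apply: cvg_at_right_filter; apply: Vc; rewrite in_itv/= lexx ltW.
  + by apply: cvg_at_left_filter; apply: Vc; rewrite in_itv/= lexx ltW.
- move=> x xab; have Vx := VG x (sub _ (subset_itv_oo_cc xab)).
  by rewrite derive1E derive_val.
Qed.

(* [psi] is the inverse of the solution [phi] of [phi'' = - G(phi)] and [q r] is
   the slope of [phi] at height [r], so that [q r ^+ 2 = E - 2 * int_a^r G]. The
   last clause says that near height [r] a parabola of curvature [- K] lies above
   [phi]. *)
Lemma ex_profile : (2%:E * \int[lebesgue_measure]_(r in `[a, b]) (G r)%:E < E%:E)%E ->
  exists psi q : R -> R,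
  [/\ forall r : R, a <= r <= b -> {for r, continuous psi},
      forall r : R, a <= r <= b -> 0 < q r <= Num.sqrt E,
      forall r s : R, a <= r <= b -> a <= s <= b ->
        (s - r) / q r <= psi s - psi r &
      forall r K : R, a < r <= b -> 0 <= K < G r -> \forall s \near r, s <= b ->
        s - r <= q r * (psi s - psi r) - K / 2 * (psi s - psi r) ^+ 2].
Proof.
move=> /ex_energy[V [VG VE]].
have Vmono (x y : R) : a - 2 < x -> x <= y -> y < b + 2 -> V x <= V y.
  move=> ax xy yb; have [c _ VxyE] := is_derive_segment_MVT VG ax xy yb.
  by rewrite -subr_ge0 VxyE mulr_ge0 ?subr_ge0// ltW.
(* [c] is the squared slope left at height [b]. Truncating [Q] below by [c] changes nothing up to
   [b] and keeps the slope positive and continuous beyond it. *)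
pose c := E - 2 * (V b - V a).
have c0 : 0 < c by rewrite /c subr_gt0.
pose Q (r : R) := Num.max (E - 2 * (V r - V a)) c.
pose q (r : R) := Num.sqrt (Q r).
have Q0 r : 0 < Q r by rewrite /Q lt_max c0 orbT.
have q0 r : 0 < q r by rewrite sqrtr_gt0.
have q2 r : q r ^+ 2 = Q r by rewrite sqr_sqrtr// ltW.
have QE r : a - 1 <= r <= b -> Q r = E - 2 * (V r - V a).
  move=> /andP[ar rb]; apply/max_idPl; rewrite /c.
  have : V r <= V b by apply: Vmono => //; lra.
  by lra.
have Qmono x y : a - 1 <= x -> x <= y -> y <= b + 1 -> Q y <= Q x.
  move=> ax xy yb; rewrite /Q ge_max !le_max lexx !orbT andbT.
  apply/orP; left; have : V x <= V y by apply: Vmono => //; lra.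
  by lra.
have qmono x y : a - 1 <= x -> x <= y -> y <= b + 1 -> q y <= q x.
  by move=> ax xy yb; rewrite ler_wsqrtr// Qmono.
have qc (r : R) : a - 1 <= r <= b + 1 -> {for r, continuous q}.
  move=> /andP[ar rb].
  have Vr : {for r, continuous V}.
    apply: (@is_derive1_continuous _ _ _ (G r)); apply: VG.
    by rewrite in_itv/=; apply/andP; split; lra.
  have Qr : {for r, continuous Q}.
    apply: continuous_max; last exact: cvg_cst.
    apply: cvgB; first exact: cvg_cst.
    by apply: cvgM; [exact: cvg_cst|apply: cvgB => //; exact: cvg_cst].
  by apply: continuous_comp Qr _; exact: sqrt_continuous.
(* Since [phi' = q(phi)], the inverse of [phi] has derivative [1 / q]. It is convex because [q]
   decreases, which gives the tangent inequality [slope]. *)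
have [|psi psiq] := @ex_antiderivative R (fun r => (q r)^-1) (a - 1) (b + 1).
  move=> x; rewrite in_itv/= => xI.
  by apply: cvgV; [rewrite gt_eqF|exact: qc].
have slope r s : a - 1 < r -> r < b + 1 -> a - 1 < s -> s < b + 1 ->
    (s - r) / q r <= psi s - psi r.
  move=> ar rb as_ sb; have [/ltW rs|sr] := ltP r s.
    have [t /andP[rt ts] ->] := is_derive_segment_MVT psiq ar rs sb.
    rewrite mulrC ler_wpM2r ?subr_ge0// lef_pV2 ?posrE// qmono//; lra.
  have [t /andP[st tr] psiE] := is_derive_segment_MVT psiq as_ sr rb.
  rewrite -lerN2 -mulNr !opprB psiE mulrC ler_wpM2l ?subr_ge0//.
  by rewrite lef_pV2 ?posrE// qmono//; lra.
exists psi, q; split.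
- move=> r rI; apply: (@is_derive1_continuous _ _ _ (q r)^-1).
  by apply: psiq; rewrite in_itv/=; apply/andP; split; lra.
- move=> r /andP[ar rb]; rewrite q0/= ler_wsqrtr// QE; last by lra.
  have : V a <= V r by apply: Vmono => //; lra.
  by lra.
- by move=> r s /andP[? ?] /andP[? ?]; apply: slope; lra.
move=> r K /andP[ar rb] /andP[K0 KG].
(* The gap between [K] and [K'] absorbs the variation of [q] near [r]: there [K * q] at one point
   stays below [K' * q] at another when one of the two is [r]. *)
pose K' := (K + G r) / 2.
have KK' : K < K' by rewrite /K'; lra.
have K'G : K' < G r by rewrite /K'; lra.
have qr : {for r, continuous q} by apply: qc; apply/andP; split; lra.
have [e /= e0 eP] : exists2 e, 0 < e & forall s, `|r - s| < e ->
    [/\ K' < G s, K * q r < K' * q s, K * q s < K' * q r & a < s].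
  apply/nbhs_ballP; near=> s; split.
  - by near: s; apply: cvgr_gt K'G; exact: Gc.
  - near: s; apply: (@cvgr_gt _ _ _ _ (fun s => K' * q s) (K' * q r)).
      by apply: cvgM => //; exact: cvg_cst.
    by rewrite ltr_pM2r.
  - near: s; apply: (@cvgr_lt _ _ _ _ (fun s => K * q s) (K * q r)).
      by apply: cvgM => //; exact: cvg_cst.
    by rewrite ltr_pM2r.
  - near: s; exact: (@cvgr_gt _ _ _ _ id r).
apply/nbhs_ballP; exists e => //= s; rewrite -ball_normE/= => rs sb.
have tau0 x y : a < x -> x <= y -> y <= b -> 0 <= psi y - psi x.
  move=> ax xy yb; apply: le_trans (slope x y _ _ _ _); [|lra..].
  by rewrite divr_ge0 ?subr_ge0// ltW.
(* The slope decreases at rate at least [K] in the variable [psi]: [q ^+ 2] drops by at least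
   [2 * K' * (y - x)], and [y - x] is at least [q y] times the increment of [psi]. Beyond [b] the
   truncated [q] is constant, hence the bound [y <= b]. *)
have drop x y : `|r - x| < e -> `|r - y| < e -> x <= y -> y <= b ->
    K * q x <= K' * q y -> K * (psi y - psi x) <= q x - q y.
  move=> rx ry xy yb Kxy.
  have [_ _ _ ax] := eP x rx.
  have dV : K' * (y - x) <= V y - V x.
    have [|||z /andP[xz zy] ->] := @is_derive_segment_MVT _ V G _ _ x y VG; [lra..|].
    rewrite ler_wpM2r ?subr_ge0// ltW//; have [] // := eP z.
    by move: rx ry; rewrite !ltr_norml => /andP[? ?] /andP[? ?]; apply/andP; split; lra.
  have dq : K' * (y - x) <= q x * (q x - q y).
    have q2xy : q x ^+ 2 - q y ^+ 2 = 2 * (V y - V x).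
      by rewrite !q2 !QE; [ring|apply/andP; split; lra..].
    have qxy : q y <= q x by apply: qmono; lra.
    have : 0 <= (q x - q y) ^+ 2 by exact: sqr_ge0.
    by move: q2xy dV; rewrite !expr2; lra.
  have tq : (psi y - psi x) * q y <= y - x.
    rewrite -ler_pdivlMr// -lerN2 !opprB -mulNr opprB.
    by apply: slope; lra.
  have t0 := tau0 x y ax xy yb.
  have K'0 : 0 < K' by lra.
  rewrite -(ler_pM2l (q0 x)); apply: le_trans dq.
  apply: le_trans (_ : K' * ((psi y - psi x) * q y) <= _); last by rewrite ler_pM2l.
  have -> : q x * (K * (psi y - psi x)) = K * q x * (psi y - psi x) by ring.
  have -> : K' * ((psi y - psi x) * q y) = K' * q y * (psi y - psi x) by ring.
  by rewrite ler_wpM2r.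
have e0r : `|r - r| < e by rewrite subrr normr0.
have N0 t : `|r - t| < e -> t <= b ->
    0 <= (q r - K * (psi t - psi r) - q t) * (t - r).
  move=> rt tb; have [_ /ltW Kr /ltW Kt at_] := eP t rt.
  have [/ltW le_rt|le_tr] := ltP r t.
    by rewrite mulr_ge0 ?subr_ge0//; have := drop _ _ e0r rt le_rt tb Kr; lra.
  rewrite -mulrNN mulr_ge0 ?oppr_ge0 ?subr_le0//.
  by have := drop _ _ rt e0r le_tr rb Kt; lra.
(* [D] is the gap between the parabola and the profile at height [t]. By [N0] its derivative has the
   sign of [t - r], so that [D] is smallest at [r], where it vanishes. *)
pose D t := q r * (psi t - psi r) - K / 2 * (psi t - psi r) ^+ 2 - (t - r).
have Dd t : t \in `](a - 1), (b + 1)[ ->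
    is_derive t 1 D ((q r - K * (psi t - psi r)) / q t - 1).
  move=> /psiq psit; rewrite /D; apply: is_derive_eq.
  by rewrite /GRing.scale/=; field; rewrite gt_eqF.
suff : D r <= D s by rewrite /D !subrr mulr0 expr0n/= mulr0 !subr0; lra.
pose D' t := (q r - K * (psi t - psi r)) / q t - 1.
have DN t : D' t * (t - r)
    = ((q r - K * (psi t - psi r) - q t) * (t - r)) / q t.
  by rewrite /D'; field; rewrite gt_eqF.
have D'r : D' r = 0 by rewrite /D' subrr mulr0 subr0 divff ?subrr// gt_eqF.
have D'ge t : `|r - t| < e -> t <= b -> r <= t -> 0 <= D' t.
  move=> rt tb; rewrite le_eqVlt => /predU1P[<-|lt_rt]; first by rewrite D'r.
  rewrite -(pmulr_lge0 (D' t) (_ : 0 < t - r)) ?subr_gt0// DN.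
  by rewrite divr_ge0 ?N0// ltW.
have D'le t : `|r - t| < e -> t <= b -> t <= r -> D' t <= 0.
  move=> rt tb; rewrite le_eqVlt => /predU1P[->|lt_tr]; first by rewrite D'r.
  rewrite -(nmulr_lge0 (D' t) (_ : t - r < 0)) ?subr_lt0// DN.
  by rewrite divr_ge0 ?N0// ltW.
have [_ _ _ as_] := eP s rs.
have between t : Num.min r s <= t -> t <= Num.max r s -> `|r - t| < e /\ t <= b.
  rewrite ge_min le_max => h1 h2; move: rs; rewrite !ltr_norml => /andP[rs1 rs2].
  clear -h1 h2 rb sb rs1 rs2.
  by split; [apply/andP; split|]; case/orP: h1; case/orP: h2; lra.
rewrite -subr_ge0; have [/ltW le_rs|le_sr] := ltP r s.
  have [||t /andP[rt ts] ->] := is_derive_segment_MVT Dd _ le_rs _; [lra|lra|].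
  have [ret tb] : `|r - t| < e /\ t <= b.
    by apply: between; rewrite ?ge_min ?le_max ?rt ?ts ?orbT.
  by apply: mulr_ge0; [exact: D'ge|rewrite subr_ge0].
have [||t /andP[st tr] DE] := is_derive_segment_MVT Dd _ le_sr _; [lra|lra|].
have [ret tb] : `|r - t| < e /\ t <= b.
  by apply: between; rewrite ?ge_min ?le_max ?st ?tr ?orbT.
rewrite -opprB DE oppr_ge0.
by apply: mulr_le0_ge0; [exact: D'le|rewrite subr_ge0].
Unshelve. all: by end_near.
Qed.
End energy_profile.

(** * Sliding the profile until it touches [u] *)

(** The touching point maximizes [psi (u x) - t x] over the compact set where [u] is at least [a].
    Convexity of [psi] turns maximality into a tangent bound of slope [s = q (u x0)], and the last
    clause of the profile turns it into a parabola bound near [x0]. *)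
Lemma sliding_profile (R : realType) (T : topologicalType) (Omega : set T)
    (u t : T -> R) (G : R -> R) (a b d E : R) (xs : T) :
  continuous G -> (forall r : R, 0 < G r) -> a < b ->
  open Omega -> compact [set x | Omega x /\ a <= u x] ->
  (forall x, Omega x -> {for x, continuous u}) -> continuous t ->
  (forall x, Omega x -> u x <= b) -> Omega xs -> u xs = b ->
  (forall x y, Omega x -> Omega y -> t x - t y <= d) ->
  (2%:E * \int[lebesgue_measure]_(r in `[a, b]) (G r)%:E < E%:E)%E ->
  d * Num.sqrt E < b - a ->
  exists x0 s, [/\ Omega x0, a < u x0 & 0 < s <= Num.sqrt E] /\
    (forall y, Omega y -> u y <= u x0 + s * (t y - t x0)) /\
    (forall K, 0 <= K < G (u x0) -> \forall y \near x0,
      u y <= u x0 + s * (t y - t x0) - K / 2 * (t y - t x0) ^+ 2).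
Proof.
move=> Gc G0 ab oO cA uc tc ub Oxs uxs td GE dE.
have [psi [q [psic qE slope touch]]] := ex_profile Gc G0 ab GE.
set A := [set x | _ /\ _] in cA.
have Axs : A xs by split => //; rewrite uxs ltW.
have uI x : A x -> a <= u x <= b by move=> [Ox ->] /=; exact: ub.
have gc : {within A, continuous (fun x => psi (u x) - t x)}.
  apply: continuous_in_subspaceT => x /set_mem Ax.
  apply: cvgB; last exact: tc.
  by apply: (continuous_comp (uc _ Ax.1)); apply: psic; exact: uI.
have [x0 /set_mem Ax0 x0max] := compact_EVT_max (ex_intro _ _ Axs) cA gc.
have [Ox0 ax0] := Ax0.
have slide y : A y -> psi (u y) - psi (u x0) <= t y - t x0.
  by move=> /mem_set/x0max; lra.
set r := u x0 in ax0 slide touch *; set s := q r.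
have rI : a <= r <= b by exact: uI.
have /andP[s0 sE] := qE r rI.
have slide_s y : A y -> u y - r <= s * (t y - t x0).
  move=> Ay; rewrite mulrC -ler_pdivrMr//.
  by apply: le_trans (slide _ Ay); apply: slope => //; exact: uI.
have ds : d * s < b - a.
  have [d0|/ltW d0] := leP 0 d.
    by apply: le_lt_trans dE; rewrite ler_wpM2l.
  by apply: le_lt_trans (_ : 0 < _); [rewrite mulr_le0_ge0// ltW|rewrite subr_gt0].
(* Where [u y < a], the tangent is still above [a]: at [xs] it is at least [b], and from [xs] to [y]
   it falls by at most [s * d < b - a]. *)
have below y : Omega y -> u y <= r + s * (t y - t x0).
  move=> Oy; have [auy|uya] := leP a (u y).
    by have := slide_s y (conj Oy auy); lra.
  have := slide_s xs Axs; rewrite uxs.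
  have : s * (t xs - t y) <= s * d by rewrite ler_wpM2l ?td// ltW.
  by lra.
(* Touching at height [a] would make the tangent climb from [a] to [b] within width [d], while
   [d * s < b - a]. *)
have ar : a < r.
  rewrite lt_neqAle ax0 andbT; apply/eqP => arE.
  have := slide_s xs Axs; rewrite uxs -arE.
  have : s * (t xs - t x0) <= s * d by rewrite ler_wpM2l ?td// ltW.
  by lra.
exists x0, s; split; first by split => //; apply/andP.
split=> // K KG; have K0 : 0 <= K by case/andP: KG.
have rb : a < r <= b by rewrite ar/=; case/andP: rI.
have uc0 : {for x0, continuous u} := uc _ Ox0.
have near_u := uc0 _ (touch r K rb KG).
have tau0 : K * (t x0 - t x0) < s by rewrite subrr mulr0.
have tau0' : K * (psi (u x0) - psi r) < s by rewrite subrr mulr0.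
near=> y.
have Oy : Omega y by near: y; exact: open_nbhs_nbhs.
have auy : a < u y by near: y; exact: (cvgr_gt _ uc0).
have Ay : A y by split => //; exact: ltW.
have /(_ (ub _ Oy)) ty : u y <= b ->
  u y - r <= s * (psi (u y) - psi r) - K / 2 * (psi (u y) - psi r) ^+ 2.
  by near: y; exact: near_u.
have t1 : K * (t y - t x0) < s.
  near: y; apply: (@cvgr_lt _ _ _ _ (fun y => K * (t y - t x0)) _ _ _ tau0).
  by apply: cvgM; [exact: cvg_cst|apply: cvgB; [exact: tc|exact: cvg_cst]].
have t2 : K * (psi (u y) - psi r) < s.
  near: y; apply: (@cvgr_lt _ _ _ _ (fun y => K * (psi (u y) - psi r)) _ _ _ tau0').
  apply: cvgM; [exact: cvg_cst|apply: cvgB; last exact: cvg_cst].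
  by apply: (continuous_comp uc0); exact: psic.
have := slide y Ay.
move: (psi (u y) - psi r) (t y - t x0) ty t1 t2 => t1 t2 ty K2 K1 t12.
(* Half of this product is the increment from [t1] to [t2] of the parabola
   [s * tau - K / 2 * tau ^+ 2], which increases as long as [K * tau < s]. Hence the increment of
   [psi] may be replaced by the larger increment of [t]. *)
have : 0 <= (t2 - t1) * (2 * s - K * (t1 + t2)).
  by rewrite mulr_ge0 ?subr_ge0//; lra.
by move: ty; rewrite -/r !expr2; lra.
Unshelve. all: by end_near.
Qed.

(* No measurability is needed, since the integral of a nonnegative function is a
   supremum over the simple functions below it. *)
Lemma ge0_le_integral_nonmeasurable d (T : measurableType d) (R : realType)
    (mu : {measure set T -> \bar R}) (D : set T) (f h : T -> \bar R) :
  (forall x, D x -> 0 <= f x)%E -> (forall x, D x -> f x <= h x)%E ->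
  (\int[mu]_(x in D) f x <= \int[mu]_(x in D) h x)%E.
Proof.
move=> f0 fh; have h0 x : D x -> (0 <= h x)%E.
  by move=> Dx; exact: le_trans (f0 _ Dx) (fh _ Dx).
rewrite !ge0_integralE//; apply: le_ereal_sup => _ [g gf <-]; exists g => // x.
by apply: le_trans (gf x) _; exact: lee_restrict.
Qed.

(** * Continuous majorants of the supremum over level sets *)

Section level_sup.
Context {R : realType} {T : topologicalType}.
Variables (Q : set T) (u F : T -> R).
Hypotheses (cQ : compact Q) (Q0 : Q !=set0).
Hypotheses (uc : {within Q, continuous u}) (Fc : {within Q, continuous F}).
Hypothesis F0 : forall x, Q x -> 0 <= F x.

(** The adjoined 0 gives the value 0 on empty levels, in accordance with [sup_norm_on]. *)
Definition level_sup (r : R) : R :=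
  sup (0 |` [set F x | x in [set x | Q x /\ u x = r]]).

(* The sup-convolution of [level_sup]: it is [k]-Lipschitz and tends to
   [level_sup], which is upper semicontinuous, as [k] grows. *)
Definition lip_sup (k : nat) (r : R) : R :=
  sup [set Num.max 0 (F x - k%:R * `|u x - r|) | x in Q].

Lemma F_bounded : exists B : R, forall x, Q x -> F x <= B.
Proof.
have [c _ cmax] := compact_EVT_max Q0 cQ Fc.
by exists (F c) => x Qx; apply: cmax; exact: mem_set.
Qed.

Lemma lip_sup_has_sup k r :
  has_sup [set Num.max 0 (F x - k%:R * `|u x - r|) | x in Q].
Proof.
have [B FB] := F_bounded; have [x Qx] := Q0; split; first by eexists; exists x.
exists B => _ [y Qy <-]; rewrite ge_max (le_trans (F0 Qy) (FB _ Qy))/=.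
by apply: le_trans (FB _ Qy); rewrite lerBlDr lerDl mulr_ge0.
Qed.

Lemma le_lip_sup k r x : Q x -> Num.max 0 (F x - k%:R * `|u x - r|) <= lip_sup k r.
Proof. by move=> Qx; apply: ub_le_sup; [case: (lip_sup_has_sup k r)|exists x]. Qed.

Lemma ge_lip_sup k r y :
  (forall x, Q x -> Num.max 0 (F x - k%:R * `|u x - r|) <= y) -> lip_sup k r <= y.
Proof.
move=> Fy; apply: ge_sup; first by case: (lip_sup_has_sup k r).
by move=> _ [x Qx <-]; exact: Fy.
Qed.

Lemma lip_sup_ge0 k r : 0 <= lip_sup k r.
Proof.
by have [x Qx] := Q0; apply: le_trans (le_lip_sup k r Qx); rewrite le_max lexx.
Qed.

Lemma lip_sup_at k x : Q x -> F x <= lip_sup k (u x).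
Proof.
move=> Qx; apply: le_trans (le_lip_sup k (u x) Qx).
by rewrite subrr normr0 mulr0 subr0 le_max lexx orbT.
Qed.

Lemma lip_sup_lipschitz k (r s : R) : lip_sup k r <= lip_sup k s + k%:R * `|r - s|.
Proof.
apply: ge_lip_sup => x Qx; rewrite ge_max; apply/andP; split.
  by rewrite addr_ge0 ?lip_sup_ge0 ?mulr_ge0.
have : F x - k%:R * `|u x - s| <= lip_sup k s.
  by apply: le_trans (le_lip_sup k s Qx); rewrite le_max lexx orbT.
have : k%:R * `|u x - s| <= k%:R * (`|u x - r| + `|r - s|).
  by rewrite ler_wpM2l// ler_distD.
by lra.
Qed.

Lemma lip_sup_continuous k : continuous (lip_sup k).
Proof.
move=> r; apply/cvgrPdist_le => e e0.
have k0 : 0 < k%:R + 1 :> R by rewrite ltr_wpDl.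
near=> s.
have rs : `|r - s| <= e / (k%:R + 1).
  near: s; have : 0 < e / (k%:R + 1) by rewrite divr_gt0.
  by move=> ek; apply: cvgr_dist_le.
have krs : k%:R * `|r - s| <= e.
  apply: le_trans (_ : (k%:R + 1) * `|r - s| <= _); first by rewrite ler_wpM2r// lerDl.
  by rewrite mulrC -ler_pdivlMr.
rewrite ler_norml; have := lip_sup_lipschitz k r s.
by have := lip_sup_lipschitz k s r; rewrite (distrC s r) => ? ?; apply/andP; split; lra.
Unshelve. all: by end_near.
Qed.

Lemma level_sup_has_sup r : has_sup (0 |` [set F x | x in [set x | Q x /\ u x = r]]).
Proof.
have [B FB] := F_bounded; have [x Qx] := Q0; split; first by exists 0; left.
exists B => _ [->|[y [Qy _] <-]]; last exact: FB.
exact: le_trans (F0 Qx) (FB _ Qx).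
Qed.

Lemma le_level_sup x : Q x -> F x <= level_sup (u x).
Proof.
by move=> Qx; apply: ub_le_sup; [case: (level_sup_has_sup (u x))|right; exists x].
Qed.

Lemma level_sup_ge0 r : 0 <= level_sup r.
Proof. by apply: ub_le_sup; [case: (level_sup_has_sup r)|left]. Qed.

Lemma ge_level_sup r y : 0 <= y -> (forall x, Q x -> u x = r -> F x <= y) ->
  level_sup r <= y.
Proof.
move=> y0 Fy; apply: ge_sup; first by case: (level_sup_has_sup r).
by move=> _ [->//|[x [Qx ux] <-]]; exact: Fy.
Qed.

Lemma lip_sup_cvg r : lip_sup k r @[k --> \oo] --> level_sup r.
Proof.
apply/cvgrPdist_le => e e0.
(* At each point of [Q] either the level is away from [r] or [F] is below
   [level_sup r + e]; by compactness this holds with a uniform margin. *)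
pose Phi x := Num.max `|u x - r| (level_sup r + e - F x).
have Phic : {within Q, continuous Phi}.
  move=> x; apply: (@continuous_max _ (subspace Q) (fun x => `|u x - r|)
    (fun x => level_sup r + e - F x)).
    apply: cvg_norm; apply: cvgB; [exact: uc|exact: cvg_cst].
  by apply: cvgB; [exact: cvg_cst|exact: Fc].
have [c /set_mem Qc cmin] := compact_EVT_min Q0 cQ Phic.
have Phi0 : 0 < Phi c.
  rewrite /Phi lt_max; have [ucr|ucr] := eqVneq (u c) r.
    by rewrite -ucr; have := le_level_sup Qc; rewrite subrr normr0 ltxx/=; lra.
  by rewrite normr_gt0 subr_eq0 ucr.
have [B FB] := F_bounded.
near=> k.
(* From this [k] on, the penalty cancels all of [F] at points whose level is at least [Phi c] away
   from [r]. *)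
have kB : B <= k%:R * Phi c.
  rewrite -ler_pdivrMr//; near: k; exact: nbhs_infty_ger.
rewrite ler_norml; apply/andP; split; last first.
  rewrite lerBlDr; apply: le_trans (_ : lip_sup k r <= _); last by rewrite lerDr ltW.
  apply: ge_level_sup; first exact: lip_sup_ge0.
  by move=> x Qx <-; exact: lip_sup_at.
suff : lip_sup k r <= level_sup r + e by lra.
apply: ge_lip_sup => x Qx; rewrite ge_max addr_ge0 ?level_sup_ge0 ?ltW//=.
have := cmin x (mem_set Qx); rewrite {2}/Phi le_max => /orP[ux|Fx].
  have : k%:R * Phi c <= k%:R * `|u x - r| by rewrite ler_wpM2l.
  by have := FB _ Qx; have := level_sup_ge0 r; lra.
have : 0 <= k%:R * `|u x - r| by rewrite mulr_ge0.
by lra.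
Unshelve. all: by end_near.
Qed.

(** The added [1 / (n + 1)] makes [G n] positive and strictly larger than [F] on its level.
    Dominated convergence with bound [B + 1] carries the inequality from [G n] to [level_sup], which
    lies below [h] on [[a, b]]. *)
Lemma le_integral_level_sup (a b c k : R) (h : R -> \bar R) :
  0 <= k ->
  (forall G : R -> R, continuous G -> (forall r, 0 < G r) ->
    (forall x, Q x -> F x < G (u x)) ->
    (c%:E <= k%:E * \int[lebesgue_measure]_(r in `[a, b]) (G r)%:E)%E) ->
  (forall r, a <= r <= b -> (0 <= h r)%E) ->
  (forall x, Q x -> a <= u x <= b -> ((F x)%:E <= h (u x))%E) ->
  (c%:E <= k%:E * \int[lebesgue_measure]_(r in `[a, b]) h r)%E.
Proof.
move=> k0 cG h0 Fh.
pose G (n : nat) (r : R) := lip_sup n r + n.+1%:R^-1.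
have Gc n : continuous (G n).
  by move=> r; apply: cvgD; [exact: lip_sup_continuous|exact: cvg_cst].
have cGn n : (c%:E <= k%:E * \int[lebesgue_measure]_(r in `[a, b]) (G n r)%:E)%E.
  apply: cG => [|r|x Qx]; first exact: Gc.
    by rewrite ltr_wpDl ?lip_sup_ge0.
  by rewrite ltr_pwDr ?invr_gt0 ?lip_sup_at.
have Gcvg r : G n r @[n --> \oo] --> level_sup r.
  rewrite -[X in _ --> X]addr0; apply: cvgD; first exact: lip_sup_cvg.
  exact: cvg_harmonic.
have [B FB] := F_bounded.
have mG n : measurable_fun `[a, b]%classic (EFin \o G n).
  apply/measurable_EFinP; apply: measurable_funTS.
  exact: continuous_measurable_fun.
have Gcvg' r : (EFin \o G n) r @[n --> \oo] --> (level_sup r)%:E.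
  by apply: cvg_EFin; [exact: nearW|exact: Gcvg].
have [] := @dominated_convergence _ (measurableTypeR R) R lebesgue_measure `[a, b]%classic
  (measurable_itv _) (fun n => EFin \o G n) (EFin \o level_sup) (cst (B + 1)%:E) mG.
- apply: (emeasurable_fun_cvg (fun n => EFin \o G n)) => // r _; exact: Gcvg'.
- by apply: aeW => r _; exact: Gcvg'.
- apply: continuous_compact_integrable; first exact: segment_compact.
  by apply: continuous_subspaceT => ?; exact: cvg_cst.
- apply: aeW => r n _; rewrite /= lee_fin ger0_norm; last first.
    by rewrite addr_ge0 ?lip_sup_ge0.
  apply: lerD; last by rewrite invf_le1 ?ler1n.
  apply: ge_lip_sup => x Qx; rewrite ge_max (le_trans (F0 Qx) (FB _ Qx))/=.
  by apply: le_trans (FB _ Qx); rewrite lerBlDr lerDl mulr_ge0.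
move=> _ _ intG; apply: le_trans (_ : _ <= k%:E * \int[lebesgue_measure]_(r in `[a, b]) (level_sup r)%:E)%E _.
  have kintG := cvgeZl (isT : k%:E \is a fin_num) intG.
  rewrite -(cvg_lim _ kintG)//; apply: lime_ge; first by apply/cvg_ex; eexists; exact: kintG.
  by apply: nearW => n; exact: cGn.
apply: lee_wpmul2l; first by rewrite lee_fin.
apply: ge0_le_integral_nonmeasurable => r /=; rewrite in_itv/= => rI.
  by rewrite lee_fin level_sup_ge0.
have := h0 r rI; case hr : (h r) => [y| |]//; last by move=> _; exact: leey.
rewrite !lee_fin => y0; apply: ge_level_sup => // x Qx uxr.
by rewrite -lee_fin -hr -uxr; apply: Fh => //; rewrite uxr.
Qed.

End level_sup.

(** * Contact points and the one-directional estimate *)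

Lemma compact_subset_near (T : topologicalType) (K P : set T) :
  compact K -> P `<=` K ->
  (forall x, K x -> ~ P x -> \forall y \near x, ~ P y) -> compact P.
Proof.
move=> cK PK nP F FF FP; have [x [Kx Fx]] := cK F FF (filterS PK FP).
exists x; split=> //; apply: contrapT => Px.
by have [y [Py /(_ Py)]] := Fx P _ FP (nP x Kx Px).
Qed.

Section contact_levels.
Context {R : realType} {T : topologicalType}.
Variables (Omega : set T) (u t f : T -> R) (a b d : R) (xs : T).
Hypotheses (oO : open Omega) (cA : compact [set x | Omega x /\ a <= u x]).
Hypotheses (uc : forall x, Omega x -> {for x, continuous u}).
Hypotheses (fc : forall x, Omega x -> {for x, continuous f}).
Hypothesis tc : continuous t.
Hypotheses (ab : a < b) (ub : forall x, Omega x -> u x <= b).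
Hypotheses (Oxs : Omega xs) (uxs : u xs = b).
Hypotheses (d0 : 0 < d) (td : forall x y, Omega x -> Omega y -> t x - t y <= d).

Let contact (p : T * R) :=
  forall y, Omega y -> u y <= u p.1 + p.2 * (t y - t p.1).

(* Contact points whose slope is bounded, so that [Q] is compact. *)
Let Q := fst @` [set p : T * R | [/\ Omega p.1 /\ a <= u p.1,
  0 <= p.2 <= (b - a) / d & contact p]].

(** For each fixed [y] the contact inequality is a weak inequality between continuous functions of
    the point and the slope. The admissible pairs therefore form a relatively closed part of a
    compact product, and [Q] is its projection. *)
Lemma compact_contact : compact Q.
Proof.
apply: continuous_compact.
  by apply: continuous_subspaceT => p; exact: cvg_fst.
apply: (@compact_subset_near _ ([set x | Omega x /\ a <= u x] `*` `[0, (b - a) / d]%classic)).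
- by apply: compact_setX => //; exact: segment_compact.
- by move=> p [? ? _]; split => //=; rewrite in_itv.
move=> [x s] [/= Ax sI] nP.
have [y [Oy yP]] : exists y, Omega y /\ u x + s * (t y - t x) < u y.
  apply: contrapT => ny; apply: nP; split => //.
  by move=> y Oy; rewrite leNgt; apply/negP => yP; apply: ny; exists y.
have gc : u p.1 + p.2 * (t y - t p.1) @[p --> (x, s)] --> u x + s * (t y - t x).
  apply: cvgD.
    by apply: (@cvg_comp _ _ _ fst u); [exact: cvg_fst|exact: uc Ax.1].
  apply: cvgM; first exact: cvg_snd.
  apply: cvgB; first exact: cvg_cst.
  by apply: (@cvg_comp _ _ _ fst t); [exact: cvg_fst|exact: tc].
near=> p; case=> _ _ /(_ y Oy) /=; apply/negP; rewrite -ltNge.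
by near: p; exact: (cvgr_lt _ gc).
Unshelve. all: by end_near.
Qed.

(** This is the whole estimate with the viscosity inequality reduced to its effect on parabolas in
    [t]. If it failed for a continuous majorant [G], the sliding profile would give a point of [Q]
    where [f] is too large. *)
Lemma sqr_oscillation_le (h : R -> \bar R) :
  (forall x s K, Omega x -> 0 < s -> 0 <= K ->
    (\forall y \near x, u y <= u x + s * (t y - t x) - K / 2 * (t y - t x) ^+ 2) ->
    K <= f x) ->
  (forall r, a <= r <= b -> (0 <= h r)%E) ->
  (forall x s, Omega x -> a <= u x <= b -> contact (x, s) ->
    ((Num.max (f x) 0)%:E <= h (u x))%E) ->
  (((b - a) ^+ 2)%:E <=
    (2 * d ^+ 2)%:E * \int[lebesgue_measure]_(r in `[a, b]) h r)%E.
Proof.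
move=> test h0 fh.
have QO x : Q x -> Omega x by move=> [p [[? _] _ _] <-].
(* The horizontal plane, of slope 0, touches at the maximum point [xs]. *)
have Q0 : Q !=set0.
  exists xs, (xs, 0) => //; split => /=; first by split=> //; rewrite uxs ltW.
    by rewrite lexx divr_ge0 ?subr_ge0 ?ltW.
  by move=> y Oy /=; rewrite mul0r addr0 uxs; exact: ub.
pose F x := Num.max (f x) 0.
have Fc : {within Q, continuous F}.
  apply: continuous_in_subspaceT => x /set_mem /QO Ox.
  by apply: continuous_max; [exact: fc|exact: cvg_cst].
have ucQ : {within Q, continuous u}.
  by apply: continuous_in_subspaceT => x /set_mem /QO Ox; exact: uc.
have d2 : 0 < 2 * d ^+ 2 by rewrite mulr_gt0// exprn_gt0.
apply: (@le_integral_level_sup _ _ Q u F compact_contact Q0 ucQ Fc) => //.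
- by move=> x _; rewrite /F le_max lexx orbT.
- exact: ltW.
- move=> G Gc G0 FG.
  have : (0 <= \int[lebesgue_measure]_(r in `[a, b]) (G r)%:E)%E.
    by apply: integral_ge0 => r _; rewrite lee_fin ltW.
  case IE : (\int[_]_(r in _) _)%E => [I| |] // I0; last first.
    by rewrite gt0_muley ?leey// lte_fin.
  rewrite -EFinM lee_fin leNgt; apply/negP => Iab.
  (* [E] is the midpoint between [2 * I] and [S ^+ 2]: enough energy to reach height [b], with
     initial slope still below [S]. *)
  pose S := (b - a) / d; pose E := (2 * I + S ^+ 2) / 2.
  have IS : 2 * I < S ^+ 2.
    by rewrite /S expr_div_n ltr_pdivlMr ?exprn_gt0//; move: Iab; lra.
  have S0 : 0 < S by rewrite divr_gt0 ?subr_gt0.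
  have E0 : 0 <= E.
    by rewrite /E divr_ge0// addr_ge0 ?sqr_ge0// mulr_ge0.
  have ES : Num.sqrt E < S.
    by rewrite -(gtr0_norm S0) -sqrtr_sqr ltr_sqrt ?exprn_gt0// /E; lra.
  have IE' : (2%:E * \int[lebesgue_measure]_(r in `[a, b]) (G r)%:E < E%:E)%E.
    by rewrite IE -EFinM lte_fin /E; lra.
  have dE : d * Num.sqrt E < b - a by rewrite mulrC -ltr_pdivlMr.
  have [x [s [[Ox ax /andP[s0 sE]] [sc touch]]]] :=
    sliding_profile Gc G0 ab oO cA uc tc ub Oxs uxs td IE' dE.
  have Qx : Q x.
    exists (x, s) => //; split => //=; first by split => //; exact: ltW.
    by rewrite ltW//= ltW// (le_lt_trans sE).
  have Fx := FG x Qx; have Fx0 : 0 <= F x by rewrite /F le_max lexx orbT.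
  have fF : f x <= F x by rewrite /F le_max lexx.
  (* A curvature strictly between [F x] and [G (u x)]: it is admissible for touching, yet exceeds
     [f x]. *)
  have KG : 0 <= (F x + G (u x)) / 2 < G (u x) by apply/andP; split; lra.
  have [K0 _] := andP KG.
  by have := test x s _ Ox s0 K0 (touch _ KG); lra.
- by move=> x [[y s] [[Oy _] _ yc] /= <-] uI; exact: fh yc.
Qed.
End contact_levels.

(** * Test functions quadratic in one coordinate *)

Section quadratic_test_functions.
Context {R : realType} {n : nat}.
Implicit Types (Omega : set 'rV[R]_n) (x v : 'rV[R]_n) (i j : 'I_n).

Lemma is_derive_coord i x v : is_derive x v (fun y : 'rV[R]_n => y 0 i) (v 0 i).
Proof.
apply: DeriveDef; first by apply: diff_derivable; exact: differentiable_coord.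
apply: cvg_lim => //; apply: cvg_near_cst; near=> h.
rewrite /= !mxE addrK /GRing.scale/= mulKf//.
by near: h; exact: nbhs_dnbhs_neq.
Unshelve. all: by end_near.
Qed.

(** This family is closed under partial derivatives, so its regularity and its Hessian come from a
    single derivative computation. *)
Definition quadratic i (tau c p q : R) (x : 'rV[R]_n) : R :=
  c + p * (x 0 i - tau) + q * (x 0 i - tau) ^+ 2.

Lemma is_derive_quadratic i tau c p q x v :
  is_derive x v (quadratic i tau c p q) ((p + 2 * q * (x 0 i - tau)) * v 0 i).
Proof.
have xi := is_derive_coord i x v.
rewrite /quadratic; apply: is_derive_eq.
by rewrite /GRing.scale/=; ring.
Qed.

Lemma partial_quadratic i j tau c p q :
  partial j (quadratic i tau c p q) =
  quadratic i tau (p * (i == j)%:R) (2 * q * (i == j)%:R) 0 :> ('rV[R]_n -> R).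
Proof.
apply/funext => x; rewrite /partial.
have xd := is_derive_quadratic i tau c p q x (delta_mx 0 j).
by rewrite derive_val mxE eqxx/= /quadratic; ring.
Qed.

Lemma quadratic_continuous i tau c p q : continuous (quadratic i tau c p q).
Proof.
have xc : continuous (fun y : 'rV[R]_n => y 0 i - tau).
  move=> x; have xi : (fun y : 'rV[R]_n => y 0 i) @ x --> x 0 i.
    exact: (@coord_continuous R 1 n 0 i).
  exact: (cvgB xi (cvg_cst tau)).
move=> x; exact: (cvgD (cvgD (cvg_cst c) (cvgM (cvg_cst p) (xc x)))
  (cvgM (cvg_cst q) (cvgM (xc x) (xc x)))).
Qed.

Lemma C1_quadratic Omega i tau c p q : C1_on Omega (quadratic i tau c p q).
Proof.
split; first by apply: continuous_subspaceT; exact: quadratic_continuous.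
move=> j; split.
  by move=> x _; have xd := is_derive_quadratic i tau c p q x (delta_mx 0 j).
rewrite partial_quadratic; apply: continuous_subspaceT.
exact: quadratic_continuous.
Qed.

Lemma C2_quadratic Omega i tau c p q : C2_on Omega (quadratic i tau c p q).
Proof.
split; first exact: C1_quadratic.
by move=> j; rewrite partial_quadratic; exact: C1_quadratic.
Qed.

Lemma grad_quadratic i x c p q :
  grad (quadratic i (x 0 i) c p q) x = p *: delta_mx 0 i.
Proof.
apply/rowP => j; rewrite !mxE partial_quadratic /quadratic subrr expr0n/=.
by rewrite !mulr0 !addr0 eq_sym.
Qed.

Lemma hessian_quadratic i x tau c p q :
  hessian (quadratic i tau c p q) x = (2 * q) *: delta_mx i i.
Proof.
apply/matrixP => j k; rewrite !mxE !partial_quadratic /quadratic.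
rewrite (eq_sym i j) (eq_sym i k).
by case: (j == i); case: (k == i); rewrite /=; ring.
Qed.

Lemma ninf_laplacian_quadratic i x c p q : p != 0 ->
  ninf_laplacian (quadratic i (x 0 i) c p q) x = 2 * q.
Proof.
move=> p0; rewrite /ninf_laplacian grad_quadratic hessian_quadratic.
have dotE (v : 'rV[R]_n) a : dot v (a *: delta_mx 0 i) = v 0 i * a.
  rewrite /dot (bigD1 i)//= !mxE !eqxx/= mulr1 big1 ?addr0// => j ji.
  by rewrite !mxE (negbTE ji) andbF !mulr0.
have -> : enorm (p *: delta_mx 0 i : 'rV[R]_n) = `|p|.
  by rewrite /enorm dotE !mxE !eqxx/= mulr1 -expr2 sqrtr_sqr.
rewrite scalerA dotE -scalemxAl -scalemxAr !mxE (bigD1 i)//= !mxE !eqxx/=.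
rewrite big1 ?addr0 => [|j ji]; last by rewrite !mxE (negbTE ji) andbF mulr0.
have p2 : (`|p|^-1 * p) ^+ 2 = 1.
  by rewrite exprMn exprVn -normrX ger0_norm ?sqr_ge0// mulVf// expf_neq0.
by rewrite !mulr1 -[RHS]mul1r -p2; ring.
Qed.

(** The positive slope makes the gradient of the test parabola nonzero at [x], where its normalized
    infinity Laplacian is the second derivative [- K]. *)
Lemma subsolution_quadratic Omega (f u : 'rV[R]_n -> R) i x (s K : R) :
  viscosity_subsolution Omega f u -> Omega x -> 0 < s ->
  (\forall y \near x,
    u y <= u x + s * (y 0 i - x 0 i) - K / 2 * (y 0 i - x 0 i) ^+ 2) ->
  K <= f x.
Proof.
move=> [_ sub] Ox s0 ux.
pose phi := quadratic i (x 0 i) (u x) s (- (K / 2)).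
have [] := sub x phi Ox (C2_quadratic _ _ _ _ _ _).
  rewrite /local_max_on /local_min_on near_withinE; near=> y => _.
  have : u y <= u x + s * (y 0 i - x 0 i) - K / 2 * (y 0 i - x 0 i) ^+ 2 by near: y.
  by rewrite /phi /quadratic /= subrr expr0n/=; lra.
rewrite ninf_laplacian_quadratic ?gt_eqF// => + _.
have -> : - (2 * - (K / 2)) = K by field.
apply; rewrite grad_quadratic scaler_eq0 gt_eqF//=.
by apply/eqP => /rowP/(_ i)/eqP; rewrite !mxE !eqxx oner_eq0.
Unshelve. all: by end_near.
Qed.

(** The reflected parabola touches [u] from below. The result has the form of the subsolution case
    for [- u] and [- f]. *)
Lemma supersolution_quadratic Omega (f u : 'rV[R]_n -> R) i x (s K : R) :
  viscosity_supersolution Omega f u -> Omega x -> 0 < s ->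
  (\forall y \near x,
    - u y <= - u x + s * (y 0 i - x 0 i) - K / 2 * (y 0 i - x 0 i) ^+ 2) ->
  K <= - f x.
Proof.
move=> [_ super] Ox s0 ux.
pose phi := quadratic i (x 0 i) (u x) (- s) (K / 2).
have [] := super x phi Ox (C2_quadratic _ _ _ _ _ _).
  rewrite /local_max_on /local_min_on near_withinE; near=> y => _.
  have : - u y <= - u x + s * (y 0 i - x 0 i) - K / 2 * (y 0 i - x 0 i) ^+ 2.
    by near: y.
  by rewrite /phi /quadratic /= subrr expr0n/=; lra.
rewrite ninf_laplacian_quadratic ?oppr_eq0 ?gt_eqF// => + _.
have -> : - (2 * (K / 2)) = - K by field.
rewrite lerNr; apply; rewrite grad_quadratic scaler_eq0 oppr_eq0 gt_eqF//=.
by apply/eqP => /rowP/(_ i)/eqP; rewrite !mxE !eqxx oner_eq0.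
Unshelve. all: by end_near.
Qed.

End quadratic_test_functions.

(** * Euclidean diameter, contact set and superlevel sets *)

Section geometry.
Context {R : realType} {n : nat}.
Implicit Types (Omega : set 'rV[R]_n) (x y : 'rV[R]_n) (u : 'rV[R]_n -> R).

Lemma coord_le_enorm x i : x 0 i <= enorm x.
Proof.
apply: le_trans (ler_norm _) _; rewrite -sqrtr_sqr ler_wsqrtr// /dot.
rewrite (bigD1 i)//= -expr2 lerDl sumr_ge0// => j _.
by rewrite -expr2 sqr_ge0.
Qed.

Lemma compact_closure_bounded Omega : bounded_set Omega -> compact (closure Omega).
Proof.
move=> bO; apply: bounded_closed_compact; last exact: closed_closure.
case: bO => M [Mr MO]; exists M; split => // M' MM' x Ox /=.
rewrite leNgt; apply/negP => M'x.
have /Ox[y [/(MO _ MM') /= + /= M'y]] : nbhs x [set y | M' < `|y|].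
  by apply: (cvgr_gt _ (@norm_continuous _ _ x)).
by rewrite leNgt M'y.
Qed.

Lemma enorm_continuous : continuous (@enorm R n).
Proof.
have dc : continuous (fun x : 'rV[R]_n => dot x x).
  apply: continuous_big => [|j _ x]; first exact: add_continuous.
  have xj := @coord_continuous R 1 n 0 j x.
  exact: (cvgM xj xj).
by move=> x; exact: (continuous_comp (dc x) (@sqrt_continuous R _)).
Qed.

(** The supremum defining [diam] bounds its set only if that set is bounded above. A bound is the
    maximum of the distance over pairs in the compact closure. *)
Lemma enorm_le_diam Omega x y :
  bounded_set Omega -> Omega x -> Omega y -> enorm (x - y) <= diam Omega.
Proof.
move=> bO Ox Oy; apply: ub_le_sup; last by exists (x, y).
have cK := compact_closure_bounded bO.
have cKK := compact_setX cK cK.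
have Dc : {within closure Omega `*` closure Omega, continuous
    (fun p : 'rV[R]_n * 'rV[R]_n => enorm (p.1 - p.2))}.
  apply: continuous_subspaceT => p.
  apply: (@continuous_comp _ _ _ (fun p : 'rV[R]_n * 'rV[R]_n => p.1 - p.2)
    (@enorm R n) p _ (@enorm_continuous _)).
  by apply: cvgB; [exact: cvg_fst|exact: cvg_snd].
have [|p _ pmax] := compact_EVT_max _ cKK Dc.
  by exists (x, y); split; exact: subset_closure.
exists (enorm (p.1 - p.2)) => _ [q [Oq1 Oq2] <-].
by apply: pmax; rewrite inE; split; exact: subset_closure.
Qed.

Lemma diam_gt0 Omega x (i : 'I_n) :
  open Omega -> bounded_set Omega -> Omega x -> 0 < diam Omega.
Proof.
move=> oO bO Ox.
have [e [e0 Oe]] : exists e : R, 0 < e /\ Omega (e *: delta_mx 0 i + x).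
  have ec : (fun e : R => e *: delta_mx 0 i + x) @ 0^'+ --> 0 *: delta_mx 0 i + x.
    apply: cvg_at_right_filter.
    apply: cvgD; last exact: cvg_cst.
    by apply: cvgZl; exact: cvg_id.
  near (0 : R)^'+ => e.
  exists e; split; first by near: e; exact: nbhs_right_gt.
  near: e; apply: ec; apply: open_nbhs_nbhs; split=> //.
  by rewrite scale0r add0r.
apply: lt_le_trans (enorm_le_diam bO Oe Ox).
apply: lt_le_trans (coord_le_enorm _ i).
by rewrite !mxE !eqxx/= addrK mulr1.
Unshelve. all: by end_near.
Qed.

(** The tangent itself competes in the infimum and takes the value [u x] at [x], below which no
    competitor can go. *)
Lemma upper_contact_setP Omega u x (i : 'I_n) (s : R) : Omega x ->
  (forall y, Omega y -> u y <= u x + s * (y 0 i - x 0 i)) ->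
  upper_contact_set Omega u x.
Proof.
move=> Ox xs; pose L y := u x + s * (y 0 i - x 0 i).
have aL : affine_fun L.
  exists (s *: delta_mx 0 i), (u x - s * x 0 i) => y.
  rewrite /dot (bigD1 i)//= !mxE !eqxx/= big1 => [|j ji].
    by rewrite /L mulr1; ring.
  by rewrite !mxE (negbTE ji) mulr0 mul0r.
have Lx : L x = u x by rewrite /L subrr mulr0 addr0.
split=> //; apply/eqP; rewrite eq_le; apply/andP; split.
  apply: lb_le_inf; first by exists (L x), L.
  by move=> _ [L' [_ uL'] <-]; exact: uL'.
apply: ge_inf; first by exists (u x) => _ [L' [_ uL'] <-]; exact: uL'.
by exists L.
Qed.

(** Levels from [a] on are met only inside [Omega], so the set is closed in the compact closure. *)
Lemma compact_superlevel Omega u (a : R) :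
  compact (closure Omega) -> {within closure Omega, continuous u} ->
  (forall x, closure Omega x -> a <= u x -> Omega x) ->
  compact [set x | Omega x /\ a <= u x].
Proof.
move=> cK uc aO; apply: (compact_subset_near cK).
  by move=> x [Ox _]; exact: subset_closure.
move=> x Kx nP.
have uxa : u x < a.
  by rewrite ltNge; apply/negP => aux; apply: nP; split=> //; exact: aO.
have /subspace_continuousP/(_ x Kx) ucx := uc.
have : \forall y \near within (closure Omega) (nbhs x), u y < a.
  exact: (cvgr_lt _ ucx _ uxa).
rewrite near_withinE; apply: filterS => y uya [Oy].
by apply/negP; rewrite -ltNge; apply: uya; exact: subset_closure.
Qed.

End geometry.

Lemma ge0_subset_integral_nonmeasurable d (T : measurableType d) (R : realType)
    (mu : {measure set T -> \bar R}) (A B : set T) (f : T -> \bar R) :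
  (forall x, B x -> 0 <= f x)%E -> A `<=` B ->
  (\int[mu]_(x in A) f x <= \int[mu]_(x in B) f x)%E.
Proof.
move=> f0 AB; rewrite (integral_mkcond A) (integral_mkcond B).
have fA0 x : (0 <= (f \_ A) x)%E by apply: erestrict_ge0 => y /AB; exact: f0.
apply: ge0_le_integral_nonmeasurable => // x _; rewrite /patch.
case: ifPn => [/set_mem/AB/mem_set ->//|_].
by case: ifPn => // /set_mem; exact: f0.
Qed.

Lemma sup_norm_on_ge0 (T : Type) (R : realType) (A : set T) (g : T -> R) :
  (0 <= sup_norm_on A g)%E.
Proof. by rewrite /sup_norm_on le_max lexx. Qed.

Lemma le_sup_norm_on (T : Type) (R : realType) (A : set T) (g : T -> R) x :
  A x -> (`|g x|%:E <= sup_norm_on A g)%E.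
Proof.
move=> Ax; rewrite /sup_norm_on le_max; apply/orP; right.
by apply: ereal_sup_ubound; exists x.
Qed.

(** * The estimate for the positive part *)

Section abp.
Context {R : realType} {n : nat}.
Variables (Omega : set 'rV[R]_n) (f u : 'rV[R]_n -> R) (i : 'I_n).
Hypotheses (oO : open Omega) (bO : bounded_set Omega).
Hypotheses (fc : {within Omega, continuous f}).
Hypotheses (uc : {within closure Omega, continuous u}).
Hypothesis test : forall (x : 'rV[R]_n) (s K : R), Omega x -> 0 < s ->
  (\forall y \near x,
    u y <= u x + s * (y 0 i - x 0 i) - K / 2 * (y 0 i - x 0 i) ^+ 2) ->
  K <= f x.

Let m := sup (u^\+ @` boundary Omega).
Let M := sup (u^\+ @` Omega).
Let g (r : R) := sup_norm_on [set x | Omega x /\ u^\+ x = r]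
  (fun x => f^\+ x * \1_(upper_contact_set Omega u) x).

Let cK : compact (closure Omega) := compact_closure_bounded bO.

Let within_closure x : closure Omega x -> Omega x \/ boundary Omega x.
Proof.
move=> Kx; have [Ox|nOx] := pselect (Omega x); [by left|right].
by split=> //; move=> /interior_subset.
Qed.

Let boundary_closure x : boundary Omega x -> closure Omega x.
Proof. by case. Qed.

Let upos_has_ub (A : set 'rV[R]_n) : A `<=` closure Omega -> has_ubound (u^\+ @` A).
Proof.
move=> AK; have [K0|Kn0] := pselect (closure Omega !=set0); last first.
  by exists 0 => _ [y /AK Ky <-]; case: Kn0; exists y.
have [xs _ xsmax] := compact_EVT_max K0 cK uc.
exists (u^\+ xs) => _ [y /AK/mem_set/xsmax uy <-].
by rewrite /funrpos /=; apply: le_max2; rewrite ?lexx.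
Qed.

Let upos_le_M x : Omega x -> u^\+ x <= M.
Proof.
move=> Ox; apply: ub_le_sup; last by exists x.
by apply: upos_has_ub; exact: subset_closure.
Qed.

Let upos_le_m x : boundary Omega x -> u^\+ x <= m.
Proof.
move=> Bx; apply: ub_le_sup; last by exists x.
exact: upos_has_ub.
Qed.

Let u_le_upos x : u x <= u^\+ x.
Proof. by rewrite /funrpos le_max lexx. Qed.

Let upos_ge0 x : 0 <= u^\+ x.
Proof. by rewrite /funrpos le_max lexx orbT. Qed.

Let m_ge0 : 0 <= m.
Proof.
have [[x Bx]|B0] := pselect (boundary Omega !=set0).
  by apply: le_trans (upos_le_m Bx).
(* The supremum of the empty set is 0 by default. *)
rewrite /m (_ : boundary Omega = set0) ?image_set0 ?sup0//.
by apply/seteqP; split=> // x Bx; apply: B0; exists x.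
Qed.

Let M_ge0 : 0 <= M.
Proof.
have [[x Ox]|O0] := pselect (Omega !=set0).
  by apply: le_trans (upos_le_M Ox).
rewrite /M (_ : Omega = set0) ?image_set0 ?sup0//.
by apply/seteqP; split=> // x Ox; apply: O0; exists x.
Qed.

(** Boundary points are limits of points of [Omega], and [u] is continuous up to the closure: a
    boundary value above [M] would force values above [M] inside. *)
Let m_le_M : m <= M.
Proof.
have [[x Bx]|B0] := pselect (boundary Omega !=set0); last first.
  rewrite /m (_ : boundary Omega = set0) ?image_set0 ?sup0//.
  by apply/seteqP; split=> // x Bx; apply: B0; exists x.
apply: ge_sup; first by exists (u^\+ x), x.
move=> _ [y By <-]; rewrite leNgt; apply/negP => My.
have uy : M < u y.
  by move: My; rewrite /funrpos lt_max => /orP[//|]; rewrite ltNge M_ge0.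
have /subspace_continuousP/(_ y (boundary_closure By)) ucy := uc.
have : \forall z \near within (closure Omega) (nbhs y), M < u z.
  exact: (cvgr_gt _ ucy _ uy).
rewrite near_withinE => nz.
have [z [Oz /= /(_ (subset_closure Oz))]] := boundary_closure By nz.
by rewrite ltNge (le_trans (u_le_upos z))// upos_le_M.
Qed.

Let level_in x : closure Omega x -> m < u x -> Omega x.
Proof.
move=> /within_closure[//|/upos_le_m ux mu].
by have := lt_le_trans mu (le_trans (u_le_upos x) ux); rewrite ltxx.
Qed.

Let max_attained : m < M -> exists2 x, Omega x & u x = M.
Proof.
move=> mM; have [[x Ox]|O0] := pselect (Omega !=set0); last first.
  move: mM; rewrite [in _ < _]/M (_ : Omega = set0) ?image_set0 ?sup0 ?ltNge ?m_ge0//.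
  by apply/seteqP; split=> // x Ox; apply: O0; exists x.
have [xs /set_mem Kxs xsmax] :=
  compact_EVT_max (ex_intro _ _ (subset_closure Ox)) cK uc.
have Mu : M <= Num.max (u xs) 0.
  apply: ge_sup; first by exists (u^\+ x), x.
  move=> _ [y Oy <-]; apply: le_max2; rewrite ?lexx//.
  by apply: xsmax; apply: mem_set; exact: subset_closure.
have {}Mu : M <= u xs.
  move: Mu; rewrite le_max => /orP[//|M0].
  by have := lt_le_trans (le_lt_trans m_ge0 mM) M0; rewrite ltxx.
have Oxs : Omega xs by apply: level_in => //; exact: lt_le_trans Mu.
exists xs => //; apply/eqP; rewrite eq_le Mu andbT.
by apply: le_trans (u_le_upos xs) _; exact: upos_le_M.
Qed.

(** The strict inequality [m < a] keeps the set where [u] is at least [a] away from the boundary,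
    hence compact. As [m] is nonnegative, [u] and [u^\+] agree on it. *)
Let sqr_oscillation_above (a : R) : m < a -> a < M ->
  (((M - a) ^+ 2)%:E <= (2 * diam Omega ^+ 2)%:E *
     \int[lebesgue_measure]_(r in `[a, M]) g r)%E.
Proof.
move=> ma aM; have [xs Oxs uxs] := max_attained (lt_trans ma aM).
have continuous_at (h : 'rV[R]_n -> R) : {within Omega, continuous h} ->
    forall x, Omega x -> {for x, continuous h}.
  by rewrite continuous_open_subspace// => hc x Ox; apply: hc; exact: mem_set.
apply: (@sqr_oscillation_le _ _ Omega u (fun x => x 0 i) f a M (diam Omega) xs) => //.
- apply: compact_superlevel => // x Kx ax.
  by apply: level_in => //; exact: lt_le_trans ax.
- by apply: continuous_at; apply: continuous_subspaceW uc; exact: subset_closure.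
- exact: continuous_at.
- exact: coord_continuous.
- by move=> x Ox; apply: le_trans (u_le_upos x) _; exact: upos_le_M.
- exact: (@diam_gt0 _ _ _ xs i).
- move=> x y Ox Oy; apply: le_trans (enorm_le_diam bO Ox Oy).
  by apply: le_trans (coord_le_enorm _ i); rewrite !mxE.
- by move=> x s K Ox s0 _; exact: test.
- by move=> r _; exact: sup_norm_on_ge0.
move=> x s Ox /andP[ax xM] xc.
have ux : u^\+ x = u x.
  by apply/max_idPl; apply: ltW; apply: lt_le_trans ax; exact: le_lt_trans ma.
have -> : Num.max (f x) 0 = `|f^\+ x * \1_(upper_contact_set Omega u) x|.
  rewrite indicE mem_set; last exact: upper_contact_setP xc.
  by rewrite mulr1 ger0_norm// /funrpos le_max lexx orbT.
by apply: le_sup_norm_on.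
Qed.

Lemma sqr_oscillation_pos_part :
  (((M - m) ^+ 2)%:E <= (2 * diam Omega ^+ 2)%:E *
     \int[lebesgue_measure]_(r in `[m, M]) g r)%E.
Proof.
have g0 r : (0 <= g r)%E by exact: sup_norm_on_ge0.
have d0 : 0 <= 2 * diam Omega ^+ 2 by rewrite mulr_ge0// sqr_ge0.
have [mM|Mm] := ltP m M; last first.
  have -> : M = m by apply/eqP; rewrite eq_le Mm m_le_M.
  rewrite subrr expr0n/= mule_ge0 ?lee_fin//; exact: integral_ge0.
set I := (_ * _)%E.
have aI a : m < a -> a < M -> (((M - a) ^+ 2)%:E <= I)%E.
  move=> ma aM; apply: le_trans (sqr_oscillation_above ma aM) _.
  apply: lee_wpmul2l; first by rewrite lee_fin.
  apply: ge0_subset_integral_nonmeasurable => // r /=.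
  by rewrite !in_itv/= => /andP[ar ->]; rewrite (le_trans (ltW ma)).
(* One admissible level suffices to exclude the value [-oo] for [I]. *)
have amid : m < (m + M) / 2 < M by apply/andP; split; lra.
have [am aM] := andP amid.
case: I aI => [J| |] aI; [|by rewrite leey|by have := aI _ am aM].
rewrite lee_fin leNgt; apply/negP => JM.
have sJ : Num.sqrt J < M - m.
  by rewrite -(gtr0_norm (_ : 0 < M - m)) ?subr_gt0// -sqrtr_sqr ltr_sqrt// exprn_gt0// subr_gt0.
have sJ0 : 0 <= Num.sqrt J by exact: sqrtr_ge0.
(* With [e] strictly between [Num.sqrt J] and [M - m], the level [M - e] is above [m] and the
   estimate there gives [e <= Num.sqrt J], a contradiction. *)
pose e := (Num.sqrt J + (M - m)) / 2.
have : (((M - (M - e)) ^+ 2)%:E <= J%:E)%E by apply: aI; rewrite /e; lra.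
rewrite lee_fin subKr => /ler_wsqrtr; rewrite sqrtr_sqr ger0_norm /e; last by lra.
by lra.
Qed.
End abp.

(** * Both estimates, with the first coordinate as sliding direction *)

Theorem theorem3p2 (R : realType) (n : nat) (hn : (2 <= n)%N)
    (Omega : set 'rV[R]_n) (Omega_open : open Omega)
    (Omega_bounded : bounded_set Omega)
    (f u : 'rV[R]_n -> R)
    (f_cont : {within Omega, continuous f})
    (u_cont : {within closure Omega, continuous u}) :
  (viscosity_subsolution Omega f u ->
    (((sup (u^\+ @` Omega) - sup (u^\+ @` boundary Omega)) ^+ 2)%R%:E <=
     (2 * diam Omega ^+ 2)%R%:E *
     \int[lebesgue_measure]_(r in
         [set` `[sup (u^\+ @` boundary Omega), sup (u^\+ @` Omega)]%R])
       sup_norm_on [set x | Omega x /\ u^\+ x = r]%R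
         (fun x => f^\+ x * \1_(upper_contact_set Omega u) x)%R)%E) /\
  (viscosity_supersolution Omega f u ->
    (((sup (u^\- @` Omega) - sup (u^\- @` boundary Omega)) ^+ 2)%R%:E <=
     (2 * diam Omega ^+ 2)%R%:E *
     \int[lebesgue_measure]_(r in
         [set` `[sup (u^\- @` boundary Omega), sup (u^\- @` Omega)]%R])
       sup_norm_on [set x | Omega x /\ u^\- x = r]%R
         (fun x => f^\- x * \1_(upper_contact_set Omega (\- u)) x)%R)%E).
Proof.
have n0 : (0 < n)%N by exact: ltnW.
split => [sub|super].
  apply: (@sqr_oscillation_pos_part _ _ Omega f u (Ordinal n0)) => // x s K Ox s0.
  exact: subsolution_quadratic sub Ox s0.
(* Negative parts are positive parts of the opposite functions, so (ii) becomes the positive-part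
   estimate for [\- u] and [\- f]. *)
rewrite -!funrposN.
apply: (@sqr_oscillation_pos_part _ _ Omega (\- f) (\- u) (Ordinal n0)) => //.
- by move=> x; apply: cvgN; exact: f_cont.
- by move=> x; apply: cvgN; exact: u_cont.
- by move=> x s K Ox s0; exact: supersolution_quadratic super Ox s0.
Qed.
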